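(* There exist a finite alphabet $\Omega$ and a language $L_0 \subseteq \Omega^*$ defined by a categorial grammar with unique category assignment, such that for every finite alphabet $\Sigma$ and every context-free language $L \subseteq \Sigma^+$ there exists a homomorphism $h \colon \Sigma \to \Omega^+$ (extended to strings by $h(a_1 \ldots a_n)=h(a_1)\ldots h(a_n)$), such that for every string $w \in \Sigma^+$, $w$ is in $L$ if and only if $h(w)$ is in $L_0$.
   Context: All languages are assumed to be without the empty string: $\Sigma^+$ is the set of non-empty strings over $\Sigma$. Let $\mathrm{BC}$ be a finite set of primitive categories. The set of categories is defined inductively: every primitive category is a category; if $A$ and $B$ are categories, then so are $(B \backslash A)$ and $(A / B)$. Strings of categories are written with semicolons between individual categories. A categorial grammar is a quadruple $(\Sigma, \mathrm{BC}, \triangleright, S)$, where $\Sigma$ is a finite alphabet, $\mathrm{BC}$ is a finite set of primitive categories, $\triangleright$ is a finite relation of category assignments of the form $a \triangleright A$ with $a \in \Sigma$ and $A$ a category, and $S$ is a category (not necessarily primitive) designated as the target category. A string of categories $\alpha$ is reducible in one step to a string of categories $\beta$ if $\alpha=\eta; A/B; B; \theta$ or $\alpha=\eta; B; B \backslash A; \theta$, while $\beta=\eta; A; \theta$, for some categories $A, B$ and some (possibly empty) strings of categories $\eta,\theta$. A string $\alpha$ is reducible to $\beta$ if it can be transformed to $\beta$ by zero or more such steps. The language defined by $G=(\Sigma, \mathrm{BC}, \triangleright, S)$ is the set $L(G)$ of all strings $a_1 \ldots a_n$ ($n \geqslant 1$, $a_i \in \Sigma$) for which there exists a string of categories $A_1;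 \ldots; A_n$ with $a_i \triangleright A_i$ for all $i$ that is reducible to $S$. A categorial grammar is with unique category assignment if for every symbol $a$ of its alphabet there is a unique category $A$ with $a \triangleright A$. *)

(* Defs.v *)
From HB Require Import structures.
From mathcomp Require Import all_boot.
From Stdlib Require Import Relation_Operators.

Set Implicit Arguments.
Unset Strict Implicit.
Unset Printing Implicit Defensive.

Definition language (T : Type) := seq T -> Prop.

Definition eps_free (T : Type) (L : language T) : Prop := ~ L [::].

Definition hom_ext (T U : Type) (h : T -> seq U) (w : seq T) : seq U :=
  flatten (map h w).

(* [Under B A] is B \ A and [Over A B] is A / B: both yield A when given B,
   on the left and on the right respectively. *)
Inductive category (P : Type) : Type :=
  | Prim of P
  | Under of category P & category P
  | Over of category P & category P.

Section CategoryEq.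
Variable P : eqType.

Fixpoint category_encode (c : category P) : GenTree.tree P :=
  match c with
  | Prim p => GenTree.Leaf p
  | Under B A => GenTree.Node 0 [:: category_encode B; category_encode A]
  | Over A B => GenTree.Node 1 [:: category_encode A; category_encode B]
  end.

Fixpoint category_decode (t : GenTree.tree P) : option (category P) :=
  match t with
  | GenTree.Leaf p => Some (Prim p)
  | GenTree.Node n [:: t1; t2] =>
      match category_decode t1, category_decode t2 with
      | Some c1, Some c2 =>
          Some (if n == 0 then Under c1 c2 else Over c1 c2)
      | _, _ => None
      end
  | _ => None
  end.

Lemma category_encodeK : pcancel category_encode category_decode.
Proof. by elim=> [p|B IHB A IHA|A IHA B IHB] //=; rewrite ?IHA ?IHB. Qed.

HB.instance Definition _ :=
  Equality.copy (category P) (pcan_type category_encodeK).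

End CategoryEq.

Inductive cat_reduce1 (P : Type) :
    seq (category P) -> seq (category P) -> Prop :=
  | ReduceOver (A B : category P) (eta theta : seq (category P)) :
      cat_reduce1 (eta ++ [:: Over A B; B] ++ theta) (eta ++ [:: A] ++ theta)
  | ReduceUnder (A B : category P) (eta theta : seq (category P)) :
      cat_reduce1 (eta ++ [:: B; Under B A] ++ theta) (eta ++ [:: A] ++ theta).

Definition cat_reducible (P : Type) :
    seq (category P) -> seq (category P) -> Prop :=
  clos_refl_trans (seq (category P)) (@cat_reduce1 P).

(* The finite relation of category assignments is given by listing its pairs. *)
Record catgrammar (Sigma BC : finType) := CatGrammar {
  cg_assign : seq (Sigma * category BC);
  cg_target : category BC
}.

Definition cg_language (Sigma BC : finType) (G : catgrammar Sigma BC) :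
    language Sigma :=
  fun w => w <> [::] /\
    exists alpha : seq (category BC),
      all2 (fun a A => (a, A) \in cg_assign G) w alpha /\
      cat_reducible alpha [:: cg_target G].

Definition unique_assignment (Sigma BC : finType)
    (G : catgrammar Sigma BC) : Prop :=
  forall a : Sigma, exists! A : category BC, (a, A) \in cg_assign G.

(* In sentential forms, [inl] marks nonterminals and [inr] terminals; empty
   right-hand sides are allowed. *)
Record cfgrammar (Sigma N : finType) := CFGrammar {
  cfg_rules : seq (N * seq (N + Sigma));
  cfg_start : N
}.

Inductive cfg_derive1 (Sigma N : finType) (G : cfgrammar Sigma N) :
    seq (N + Sigma) -> seq (N + Sigma) -> Prop :=
  | CFGDerive1 (X : N) (rhs u v : seq (N + Sigma)) :
      (X, rhs) \in cfg_rules G ->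
      cfg_derive1 G (u ++ [:: inl X] ++ v) (u ++ rhs ++ v).

Definition cfg_derives (Sigma N : finType) (G : cfgrammar Sigma N) :
    seq (N + Sigma) -> seq (N + Sigma) -> Prop :=
  clos_refl_trans (seq (N + Sigma)) (cfg_derive1 G).

Definition cfg_language (Sigma N : finType) (G : cfgrammar Sigma N) :
    language Sigma :=
  fun w => cfg_derives G [:: inl (cfg_start G)] (map inr w).

Definition context_free (Sigma : finType) (L : language Sigma) : Prop :=
  exists (N : finType) (G : cfgrammar Sigma N),
    forall w : seq Sigma, L w <-> cfg_language G w.

(* Main.v *)
Require Import Defs.
From HB Require Import structures.
From mathcomp Require Import all_boot.
From mathcomp Require Import boolp.
From Stdlib Require Import Relation_Operators.

Set Implicit Arguments.
Unset Strict Implicit.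
Unset Printing Implicit Defensive.

(* The categories i\j, i\(t/t), i\((t/t)\j) and t/t over finitely many
   primitive categories, each assigned to a symbol of its own, describe a
   pushdown machine: the categories t/t are its stack symbols and a primitive
   category is its state. The machine is deterministic except that t/t may be
   applied to t, so that in the state t it may discard tokens t lying on the
   stack. Put L in Greibach normal form, write its nonterminals on the stack in
   unary, and let h(a) list, for every rule X -> a Y1 ... Yk, a block of symbols
   that either only adds junk, or replaces X by Y1 ... Yk on
   the stack. A block first pushes a decoy X and then discards it or not; it
   pops one X, the decoy or the real one; it pushes Y1 ... Yk and then discards
   them or not. Markers pushed together with Y1 ... Yk spoil the stack forever if
   these two choices disagree.

   The normal form is obtained by the left-corner construction: its
   nonterminals are pairs (A, B) generating the u such that A derives B u. *)

(** * The grammar and its pushdown machine *)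

(* [Ready] and [Done] top the stack before and after the rule for the current
   letter is applied. [Junk] is left by the blocks that apply no rule. [Tail]
   marks the place where a rule was applied, below its right-hand side, and
   [Bottom] the bottom of the stack. [Zero] and [One] encode nonterminals. *)
Inductive token := Ready | Done | Tail | Junk | Bottom | Zero | One.

Definition token_rank (t : token) : 'I_7 :=
  match t with
  | Ready => @Ordinal 7 0 isT | Done => @Ordinal 7 1 isT
  | Tail => @Ordinal 7 2 isT | Junk => @Ordinal 7 3 isT
  | Bottom => @Ordinal 7 4 isT | Zero => @Ordinal 7 5 isT
  | One => @Ordinal 7 6 isT
  end.

Definition token_unrank (i : 'I_7) : token :=
  nth Ready [:: Ready; Done; Tail; Junk; Bottom; Zero; One] i.

Lemma token_rankK : cancel token_rank token_unrank.
Proof. by case. Qed.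

HB.instance Definition _ := Finite.copy token (can_type token_rankK).

Definition state := option token.

(* The state [None] cannot absorb anything from the stack. *)
Inductive symbol :=
  | Start of state
  | Push of token
  | Goto of state & state
  | Pop of state & token & state
  | Put of state & token.

Definition symbol_encode (x : symbol) :
    state + token + state * state + state * token * state + state * token :=
  match x with
  | Start k => inl (inl (inl (inl k)))
  | Push t => inl (inl (inl (inr t)))
  | Goto i j => inl (inl (inr (i, j)))
  | Pop i t j => inl (inr (i, t, j))
  | Put i t => inr (i, t)
  end.

Definition symbol_decode
    (x : state + token + state * state + state * token * state +
         state * token) : symbol :=
  match x with
  | inl (inl (inl (inl k))) => Start k
  | inl (inl (inl (inr t))) => Push t
  | inl (inl (inr (i, j))) => Goto i j
  | inl (inr (i, t, j)) => Pop i t j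
  | inr (i, t) => Put i t
  end.

Lemma symbol_encodeK : cancel symbol_encode symbol_decode.
Proof. by case. Qed.

HB.instance Definition _ := Finite.copy symbol (can_type symbol_encodeK).

Definition token_cat (t : token) : category state :=
  Over (Prim (Some t)) (Prim (Some t)).

Definition symbol_cat (x : symbol) : category state :=
  match x with
  | Start k => Prim k
  | Push t => token_cat t
  | Goto i j => Under (Prim i) (Prim j)
  | Pop i t j => Under (Prim i) (Under (token_cat t) (Prim j))
  | Put i t => Under (Prim i) (token_cat t)
  end.

Definition machine_grammar : catgrammar symbol state :=
  CatGrammar [seq (x, symbol_cat x) | x <- enum {: symbol}] (token_cat Ready).

Lemma mem_machine_grammar (x : symbol) (c : category state) :
  ((x, c) \in cg_assign machine_grammar) = (c == symbol_cat x).
Proof.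
apply/mapP/eqP => [[y _ [-> ->]] //|->].
by exists x; rewrite ?mem_enum.
Qed.

Lemma machine_grammar_unique : unique_assignment machine_grammar.
Proof.
move=> x; exists (symbol_cat x); split; first by rewrite mem_machine_grammar.
by move=> c; rewrite mem_machine_grammar => /eqP.
Qed.

(* A configuration is a stack of tokens, top first, and possibly a current
   state. The state [Some t] may absorb tokens [t] from the top at any time;
   this is the application of [t/t] to a [t] on its right. *)
Definition config : Type := seq token * option state.

Inductive run : seq symbol -> config -> config -> Prop :=
  | run_nil x : run [::] x x
  | run_absorb t g s y :
      run s (g, Some (Some t)) y -> run s (t :: g, Some (Some t)) y
  | run_start k g s y : run s (g, Some k) y -> run (Start k :: s) (g, None) y
  | run_push t g s y : run s (t :: g, None) y -> run (Push t :: s) (g, None) y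
  | run_goto i j g s y :
      run s (g, Some j) y -> run (Goto i j :: s) (g, Some i) y
  | run_pop i t j g s y :
      run s (g, Some j) y -> run (Pop i t j :: s) (t :: g, Some i) y
  | run_put i t g s y :
      run s (t :: g, None) y -> run (Put i t :: s) (g, Some i) y.

Lemma run_cat s1 s2 x y z : run s1 x y -> run s2 y z -> run (s1 ++ s2) x z.
Proof. by move=> r1 r2; elim: r1 r2 => /=; eauto using run. Qed.

(** * Reductions of category strings and runs of the machine *)

Definition config_cats (x : config) : seq (category state) :=
  rev (map token_cat x.1) ++ (if x.2 is Some k then [:: Prim k] else [::]).

Lemma reduce_over (P : Type) (a b : category P) u v :
  cat_reducible (u ++ [:: Over a b, b & v]) (u ++ a :: v).
Proof. exact: rt_step (ReduceOver a b u v). Qed.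

Lemma reduce_under (P : Type) (a b : category P) u v :
  cat_reducible (u ++ [:: b, Under b a & v]) (u ++ a :: v).
Proof. exact: rt_step (ReduceUnder a b u v). Qed.

Lemma run_reducible s x y :
  run s x y -> cat_reducible (config_cats x ++ map symbol_cat s) (config_cats y).
Proof.
elim=> {s x y} [x|t g s y _|k g s y _|t g s y _|i j g s y _|i t j g s y _|i t g s y _];
  rewrite /config_cats /= ?rev_cons -?cats1 ?cats0 -?catA //=.
- exact: rt_refl.
- by apply: rt_trans; apply: reduce_over.
- by apply: rt_trans; apply: reduce_under.
- move=> IH; have red := @reduce_under _ (Under (token_cat t) (Prim j)) (Prim i)
    (rev (map token_cat g) ++ [:: token_cat t]) (map symbol_cat s).
  rewrite -!catA in red; apply: rt_trans red (rt_trans _ _ _ _ _ _ IH).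
  exact: reduce_under.
- by apply: rt_trans; apply: reduce_under.
Qed.

(* A model of the categories met during a reduction: a factor of the input is
   interpreted by the run it performs, uniformly in the rest of the stack. *)
Inductive means : category state -> seq symbol -> Prop :=
  | means_prim k s : (forall g, run s (g, None) (g, Some k)) -> means (Prim k) s
  | means_token t s :
      (forall g, run s (g, None) (t :: g, None)) -> means (token_cat t) s
  | means_goto i j s :
      (forall g, run s (g, Some i) (g, Some j)) ->
      means (Under (Prim i) (Prim j)) s
  | means_pop i t j s :
      (forall g, run s (t :: g, Some i) (g, Some j)) ->
      means (Under (Prim i) (Under (token_cat t) (Prim j))) s
  | means_pop_idle t j s :
      (forall g, run s (t :: g, None) (g, Some j)) ->
      means (Under (token_cat t) (Prim j)) s
  | means_put i t s :
      (forall g, run s (g, Some i) (t :: g, None)) ->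
      means (Under (Prim i) (token_cat t)) s.

Lemma means_symbol x : means (symbol_cat x) [:: x].
Proof. by case: x => *; constructor=> g; do !constructor. Qed.

(** Only [t/t] has a meaning among the categories [a/b]: the first factor pushes [t], the second
    enters the state [t], which then absorbs it. *)
Lemma means_over a b s1 s2 : means (Over a b) s1 -> means b s2 -> means a (s1 ++ s2).
Proof.
move=> m1 m2; inversion m1 as [|t s r1 ea| | | |]; subst.
inversion m2 as [k s' r2 ek es'| | | | |]; subst.
constructor=> g; rewrite -[s2]cats0 catA; apply: run_cat (_ : run _ _ (t :: g, _)) _.
  exact: run_cat (r1 g) (r2 _).
by do 2!constructor.
Qed.

Lemma means_under a b s1 s2 :
  means b s1 -> means (Under b a) s2 -> means a (s1 ++ s2).
Proof.
move=> m1 m2; inversion m2 as [| |i j s r|i t j s r|t j s r|i t s r]; subst;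
  inversion m1 as [k s' r'|t' s' r'| | | |]; subst; constructor=> g;
  exact: run_cat (r' _) (r _).
Qed.

Inductive reads : seq (category state) -> seq symbol -> Prop :=
  | reads_nil : reads [::] [::]
  | reads_cons c al s1 s2 :
      means c s1 -> reads al s2 -> reads (c :: al) (s1 ++ s2).

Lemma reads_symbols s : reads (map symbol_cat s) s.
Proof.
elim: s => [|x s IHs] /=; first by constructor.
exact: reads_cons (means_symbol x) IHs.
Qed.

Lemma reads_split al be s :
  reads (al ++ be) s -> exists s1 s2, [/\ s = s1 ++ s2, reads al s1 & reads be s2].
Proof.
elim: al s => [|c al IHal] s /= r.
  by exists [::], s; split=> //; constructor.
inversion r as [|c' al' s1 s2 m r' e1 e2]; subst.
have [u [v [-> ru rv]]] := IHal _ r'.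
by exists (s1 ++ u), v; split; rewrite ?catA //; constructor.
Qed.

Lemma reads_join al be s1 s2 :
  reads al s1 -> reads be s2 -> reads (al ++ be) (s1 ++ s2).
Proof.
by move=> r1 r2; elim: r1 => //= c al' u v m _ IH; rewrite -catA; constructor.
Qed.

Lemma reads_pair a b c al s :
  (forall s1 s2, means a s1 -> means b s2 -> means c (s1 ++ s2)) ->
  reads [:: a, b & al] s -> reads (c :: al) s.
Proof.
move=> m r; inversion r as [|? ? s1 s2 m1 r' e1 e2]; subst.
inversion r' as [|? ? s3 s4 m2 r'' e1 e2]; subst.
by rewrite catA; constructor=> //; apply: m.
Qed.

(** Reductions may contract anywhere and in any order; as meanings are uniform in the stack, each
    step just concatenates two neighbouring factors. *)
Lemma reads_reducible al be s : cat_reducible al be -> reads al s -> reads be s.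
Proof.
elim=> {al be} [al be st|al|al be ga _ IH1 _ IH2 r]; last 2 first.
- by [].
- by apply/IH2/IH1.
case: st => a b eta theta /reads_split[u [v [-> ru rv]]];
  apply: reads_join ru (reads_pair _ rv).
  exact: means_over.
exact: means_under.
Qed.

Lemma machine_languageP s :
  cg_language machine_grammar s <->
  s <> [::] /\ run s ([::], None) ([:: Ready], None).
Proof.
split=> -[s0 H]; split=> //.
  case: H => al [/= hal red].
  have eal : al = map symbol_cat s.
    elim: s al {s0 red} hal => [|x s IHs] [|c al] //= /andP[].
    by rewrite mem_machine_grammar => /eqP-> /IHs->.
  subst al; have := reads_reducible red (reads_symbols s) => r.
  inversion r as [|? ? s1 s2 m r' e1 e2]; inversion r'; subst.
  by rewrite cats0; inversion m as [|t s' rs et| | | |]; subst.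
exists (map symbol_cat s); split; last exact: (run_reducible H).
by elim: s {s0 H} => //= x s ->; rewrite mem_machine_grammar eqxx.
Qed.

(** * Blocks *)

(** Absorption is the only freedom of the machine: [p] is what the state [k] absorbed before the
    symbol was read. *)
Lemma run_goto_inv i j k g s y :
  run (Goto i j :: s) (g, Some k) y ->
  exists p g', [/\ g = p ++ g', all (fun t => Some t == k) p &
                   run s (g', Some j) y].
Proof.
move er: (_ :: s) => s'; move ex: (g, Some k) => x r.
elim: r g er ex => // [t g1 s1 y1 _ IH g es [eg ek]|i1 j1 g1 s1 y1 r _ g [ei ej es] [eg ek]].
  subst; have [p [g' [-> hp r]]] := IH _ erefl erefl.
  by exists (t :: p), g'; split=> //=; rewrite eqxx.
by subst; exists [::], g1.
Qed.

Lemma run_pop_inv i t j k g s y :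
  run (Pop i t j :: s) (g, Some k) y ->
  exists p g', [/\ g = p ++ t :: g', all (fun u => Some u == k) p &
                   run s (g', Some j) y].
Proof.
move er: (_ :: s) => s'; move ex: (g, Some k) => x r.
elim: r g er ex => // [u g1 s1 y1 _ IH g es [eg ek]|i1 t1 j1 g1 s1 y1 r _ g [ei et ej es] [eg ek]].
  subst; have [p [g' [-> hp r]]] := IH _ erefl erefl.
  by exists (u :: p), g'; split=> //=; rewrite eqxx.
by subst; exists [::], g1.
Qed.

Lemma run_put_inv i t k g s y :
  run (Put i t :: s) (g, Some k) y ->
  exists p g', [/\ g = p ++ g', all (fun u => Some u == k) p &
                   run s (t :: g', None) y].
Proof.
move er: (_ :: s) => s'; move ex: (g, Some k) => x r.
elim: r g er ex => // [u g1 s1 y1 _ IH g es [eg ek]|i1 t1 g1 s1 y1 r _ g [ei et es] [eg ek]].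
  subst; have [p [g' [-> hp r]]] := IH _ erefl erefl.
  by exists (u :: p), g'; split=> //=; rewrite eqxx.
by subst; exists [::], g1.
Qed.

Lemma run_start_inv k g s y : run (Start k :: s) (g, None) y -> run s (g, Some k) y.
Proof. by move=> r; inversion r. Qed.

Lemma run_push_inv t g s y : run (Push t :: s) (g, None) y -> run s (t :: g, None) y.
Proof. by move=> r; inversion r. Qed.

Lemma run_absorbs t p g s y : all (pred1 t) p ->
  run s (g, Some (Some t)) y -> run s (p ++ g, Some (Some t)) y.
Proof.
by elim: p => //= u p IHp /andP[/eqP-> /IHp r] /r; apply: run_absorb.
Qed.

Definition pushes (g : seq token) : seq symbol := [seq Push t | t <- rev g].

Definition pops (g : seq token) : seq symbol := [seq Pop None t None | t <- g].

Fixpoint walk (i : state) (js : seq state) : seq symbol :=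
  if js is j :: js' then Goto i j :: walk j js' else [::].

(* Discards [g] from the top of the stack, or any part of it. *)
Definition skip (g : seq token) (k : state) : seq symbol :=
  if g is t :: g' then Start (Some t) :: walk (Some t) (rcons (map Some g') k)
  else [:: Start k].

Lemma run_pushes h g s y : run s (h ++ g, None) y -> run (pushes h ++ s) (g, None) y.
Proof.
elim: h s => //= t h IHh s r.
rewrite /pushes rev_cons map_rcons cat_rcons; exact/IHh/run_push.
Qed.

Lemma run_pushes_inv h g s y :
  run (pushes h ++ s) (g, None) y -> run s (h ++ g, None) y.
Proof.
elim: h s => //= t h IHh s.
by rewrite /pushes rev_cons map_rcons cat_rcons => /IHh/run_push_inv.
Qed.

Lemma run_pops h g s y :
  run s (g, Some None) y -> run (pops h ++ s) (h ++ g, Some None) y.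
Proof. by elim: h => //= t h IHh /IHh; apply: run_pop. Qed.

Lemma idle_absorbs (p : seq token) : all (fun t => Some t == None) p -> p = [::].
Proof. by case: p. Qed.

Lemma run_pops_inv h g s y :
  run (pops h ++ s) (g, Some None) y ->
  exists2 g', g = h ++ g' & run s (g', Some None) y.
Proof.
elim: h g => [|t h IHh] g /=; first by exists g.
by case/run_pop_inv=> p [g1 [-> /idle_absorbs-> /IHh[g' -> r]]]; exists g'.
Qed.

Lemma run_walk i js g s y :
  run s (g, Some (last i js)) y -> run (walk i js ++ s) (g, Some i) y.
Proof. by elim: js i => //= j js IHjs i /IHjs; apply: run_goto. Qed.

Lemma run_walk_inv i js g s y :
  run (walk i js ++ s) (g, Some i) y ->
  exists p g', [/\ g = p ++ g', all (fun t => Some t \in belast i js) p &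
                   run s (g', Some (last i js)) y].
Proof.
elim: js i g => [|j js IHjs] i g /=; first by exists [::], g.
case/run_goto_inv=> p [g1 [-> hp /IHjs[q [g' [-> hq r]]]]].
exists (p ++ q), g'; split; rewrite ?catA // all_cat; apply/andP; split.
  by apply: sub_all hp => t; rewrite inE => ->.
by apply: sub_all hq => t; rewrite inE orbC => ->.
Qed.

Lemma run_skip h k g s y : run s (g, Some k) y -> run (skip h k ++ s) (g, None) y.
Proof.
case: h => [|t h] r; apply: run_start => //.
by apply: run_walk; rewrite last_rcons.
Qed.

Lemma run_skip_absorb h k g s y :
  run s (g, Some k) y -> run (skip h k ++ s) (h ++ g, None) y.
Proof.
case: h => [|t h] r; apply: run_start => //; apply: run_absorb.
by elim: h t => [|u h IHh] t /=; apply: run_goto => //; apply: run_absorb.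
Qed.

(** The order inside [q] is not recorded. In both uses [t] does not occur in [h] and is the next
    token popped, which fixes where [q] ends. *)
Lemma run_skip_inv t h k g s y :
  run (skip (t :: h) k ++ s) (g, None) y ->
  exists p q g', [/\ g = p ++ q ++ g', all (pred1 t) p, all (mem h) q &
                     run s (g', Some k) y].
Proof.
move/run_start_inv; case: h => [|u h] /=.
  case/run_goto_inv=> p [g' [-> hp r]].
  by exists p, [::], g'; split.
case/run_goto_inv=> p [g1 [-> hp /run_walk_inv[q [g' [-> hq r]]]]].
exists p, q, g'; split=> //.
  apply: sub_all hq => v; rewrite belast_rcons -map_cons mem_map //.
  by move=> ? ? [].
by rewrite last_rcons in r.
Qed.

Lemma split_unique (T : Type) (P : pred T) p1 x1 q1 p2 x2 q2 :
  p1 ++ x1 :: q1 = p2 ++ x2 :: q2 ->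
  all P p1 -> all P p2 -> ~~ P x1 -> ~~ P x2 -> [/\ p1 = p2, x1 = x2 & q1 = q2].
Proof.
elim: p1 p2 => [|a p1 IHp] [|b p2] /=.
- by case=> -> ->.
- by case=> -> _ _ /andP[->].
- by case=> <- _ /andP[->].
by case=> -> /IHp{}IHp /andP[_ h1] /andP[_ h2] n1 n2; case: IHp => // -> -> ->.
Qed.

Section Blocks.
Variable M : finType.
Implicit Types (X Y : M) (ga de : seq M).

(** Unary, closed by [Zero], so that codes are nonempty and none is a prefix of another. *)
Definition code X : seq token := rcons (nseq (enum_rank X) One) Zero.

Definition codes ga : seq token := flatten (map code ga).

(* After [skip], [Tail] must be on top: either nothing was discarded, and it is
   the upper copy, or everything pushed here was, and it is the one below; then
   [t] must follow, which holds only if nothing was taken from the real stack. *)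
Definition replace (t : token) ga : seq symbol :=
  pushes ([:: Tail; t; Done] ++ codes ga) ++
  skip ([:: Tail; t; Done] ++ codes ga) None ++
  pops [:: Tail; t] ++ [:: Put None Junk].

(* Blocks with no left-hand side initialize the stack. *)
Definition block (r : option M * seq M) : seq symbol :=
  if r.1 is Some X then
    pushes (Ready :: code X ++ [:: Junk]) ++ skip (Ready :: code X) (Some Junk) ++
    Pop (Some Junk) Ready None :: pops (code X) ++
    Put None Tail :: replace Junk r.2
  else [:: Start (Some Junk); Put (Some Junk) Bottom; Push Tail] ++
       replace Bottom r.2.

Definition close : seq symbol :=
  [:: Start (Some Junk); Pop (Some Junk) Done (Some Tail);
      Goto (Some Tail) (Some Bottom); Put (Some Bottom) Ready].

Definition digit (t : token) : bool := (t == One) || (t == Zero).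

Lemma digit_code X : all digit (code X).
Proof. by rewrite all_rcons all_nseq /= orbT. Qed.

Lemma digit_codes ga : all digit (codes ga).
Proof. by elim: ga => //= X ga IHga; rewrite /codes /= all_cat digit_code. Qed.

Lemma code_inj X Y g1 g2 : code X ++ g1 = code Y ++ g2 -> X = Y /\ g1 = g2.
Proof.
have aO m : all (pred1 One) (nseq m One) by rewrite all_nseq orbT.
rewrite /code !cat_rcons => /(@split_unique _ (pred1 One))[] // e _ ->.
split=> //; apply/enum_rank_inj/val_inj.
by rewrite /= -(size_nseq (enum_rank X) One) e size_nseq.
Qed.

Lemma run_replace t ga g s y :
  run s (Junk :: Done :: codes ga ++ Tail :: g, None) y ->
  run (replace t ga ++ s) (Tail :: g, None) y.
Proof.
move=> r; rewrite /replace -!catA; apply: run_pushes; apply: run_skip.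
by apply: (@run_pops [:: Tail; t] (Done :: _)); apply: run_put.
Qed.

Lemma run_replace_undo t ga g s y :
  run s (Junk :: g, None) y ->
  run (replace t ga ++ s) (Tail :: t :: g, None) y.
Proof.
move=> r; rewrite /replace -!catA; apply: run_pushes; apply: run_skip_absorb.
by apply: (@run_pops [:: Tail; t]); apply: run_put.
Qed.

(** If the upper [Tail] stays, nothing was discarded. If it goes, discarding must reach the [Tail]
    below, because none lies between the two. *)
Lemma run_replace_inv t ga g s y : t != Tail ->
  run (replace t ga ++ s) (Tail :: g, None) y ->
  run s (Junk :: Done :: codes ga ++ Tail :: g, None) y \/
  exists2 g', g = t :: g' & run s (Junk :: g', None) y.
Proof.
move=> tT; rewrite /replace -!catA => /run_pushes_inv/run_skip_inv.
move=> [p [q [g1 [eg hp hq /run_pops_inv[g2 eg1]]]]].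
case/run_put_inv=> p' [g3 [eg2 /idle_absorbs ep' r]]; subst.
have nq (h : seq token) :
    all (mem (t :: Done :: codes ga)) h -> all (predC1 Tail) h.
  apply: sub_all => u; rewrite !inE => /or3P[/eqP->|/eqP->|] //.
  by move/(allP (digit_codes ga)); case: u.
have nqt : all (predC1 Tail) (t :: Done :: codes ga) by apply/nq/allP.
case: p hp eg => [|u p] /=.
  move=> _; case: q hq => [|u q] /= hq; first by case=> e; subst; left.
  by case=> eu _; have:= nq (u :: q) hq; rewrite /= -eu.
case/andP=> /eqP-> hp; case: p hp => [|v p] /=.
  move=> _ [e]; right; exists g3 => //.
  have [] // := @split_unique _ _ (t :: Done :: codes ga) _ _ q _ _ e nqt.
  exact: nq.
by case/andP=> /eqP-> _ [et]; rewrite et eqxx in tT.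
Qed.

Lemma block_ruleE X ga s :
  block (Some X, ga) ++ s =
  pushes (Ready :: code X ++ [:: Junk]) ++ skip (Ready :: code X) (Some Junk) ++
  Pop (Some Junk) Ready None :: pops (code X) ++
  Put None Tail :: replace Junk ga ++ s.
Proof.
have e (p1 p2 p3 p4 : seq symbol) x z :
    (p1 ++ p2 ++ x :: p3 ++ z :: p4) ++ s = p1 ++ p2 ++ x :: p3 ++ z :: p4 ++ s.
  by rewrite -!catA /= -catA.
exact: e.
Qed.

Lemma run_rule X ga g s y :
  run (skip (Ready :: code X) (Some Junk) ++ Pop (Some Junk) Ready None ::
       pops (code X) ++ Put None Tail :: replace Junk ga ++ s)
      (Ready :: code X ++ Junk :: g, None) y ->
  run (block (Some X, ga) ++ s) (g, None) y.
Proof.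
by move=> r; rewrite block_ruleE; apply: run_pushes; rewrite /= -catA.
Qed.

Lemma run_block_skip r g s y :
  run s (Junk :: g, None) y -> run (block r ++ s) (g, None) y.
Proof.
case: r => -[X|] ga r.
  apply: run_rule; apply: run_skip; apply: run_pop; apply: run_pops.
  by apply: run_put; apply: run_replace_undo.
rewrite /block /=; apply: run_start; apply: run_put; apply: run_push.
exact: run_replace_undo.
Qed.

Lemma run_block_rule X ga p g s y : all (pred1 Junk) p ->
  run s (Junk :: Done :: codes ga ++ Tail :: g, None) y ->
  run (block (Some X, ga) ++ s) (p ++ Ready :: code X ++ g, None) y.
Proof.
move=> hp r; apply: run_rule.
have ec h : Ready :: code X ++ h = (Ready :: code X) ++ h by [].
rewrite ec; apply: run_skip_absorb; apply: run_absorb; apply: run_absorbs => //.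
apply: run_pop; apply: run_pops; apply: run_put; exact: run_replace.
Qed.

Lemma run_block_initial ga p s y : all (pred1 Junk) p ->
  run s (Junk :: Done :: codes ga ++ [:: Tail; Bottom], None) y ->
  run (block (None, ga) ++ s) (p, None) y.
Proof.
move=> hp r; rewrite /block /=; apply: run_start.
rewrite -[p]cats0; apply: run_absorbs => //; apply: run_put; apply: run_push.
exact: run_replace.
Qed.

(** The [Ready] that gets popped is the decoy if nothing was discarded. Otherwise the whole decoy
    and the [Junk] around it are gone, and it is the real one. *)
Lemma run_rule_inv X ga g s y :
  run (block (Some X, ga) ++ s) (g, None) y ->
  exists2 g', run (replace Junk ga ++ s) (Tail :: g', None) y &
    g' = Junk :: g \/
    exists2 p, all (pred1 Junk) p & g = p ++ Ready :: code X ++ g'.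
Proof.
rewrite block_ruleE => /run_pushes_inv.
rewrite [_ ++ g]/= -catA /= => /run_skip_inv[p [q [g1 [eg hp hq]]]].
case/run_pop_inv=> j [g2 [eg1 hj /run_pops_inv[g3 eg2]]].
case/run_put_inv=> j' [g4 [eg3 /idle_absorbs ej' r]]; subst.
exists g4 => //.
have dq (h : seq token) : all (mem (code X)) h -> all digit h.
  by apply: sub_all => u; apply: (allP (digit_code X)).
case: p hp eg => [|u p] /=.
  move=> _; case: q hq => [|u q] /= hq.
    case: j hj => [|u j] /= hj; last by case=> eu; rewrite -eu in hj.
    by case=> /code_inj[_ <-]; left.
  by case=> eu; have:= dq (u :: q) hq; rewrite /= -eu.
(* No second [Ready] is discarded here, since [code X] starts with a digit. *)
case/andP=> /eqP-> hp; case: p hp => [|v p] /=; last first.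
  by case/andP=> /eqP-> _ [] /(congr1 (head Zero)); rewrite /code; case: (nat_of_ord _).
(* [j] was absorbed by the state [Junk]; it contains the [Junk] under the decoy, as the next token
   popped is [Ready]. *)
move=> _ [e]; right; case: j hj e => [|w j] /=.
  by move=> _ /(@split_unique _ digit)[] //; [exact: digit_code | exact: dq].
case/andP=> /eqP[->] hj /(@split_unique _ digit)[] //.
- exact: digit_code.
- exact: dq.
by move=> _ _ ->; exists j.
Qed.

(** Decoy and undone: only junk is added. Decoy and kept: [Tail] lies on [Junk]. Real and kept: the
    rule is applied. Real and undone: this needs [Junk] right under the code of [X]. *)
Lemma run_block_rule_inv X ga g s y :
  run (block (Some X, ga) ++ s) (g, None) y ->
  [\/ run s (Junk :: g, None) y,
      run s (Junk :: Done :: codes ga ++ Tail :: Junk :: g, None) y |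
      exists p g', [/\ all (pred1 Junk) p, g = p ++ Ready :: code X ++ g' &
        run s (Junk :: Done :: codes ga ++ Tail :: g', None) y \/
        exists2 g'', g' = Junk :: g'' & run s (g', None) y]].
Proof.
case/run_rule_inv=> g' /run_replace_inv[//|r|[g'' -> r]] [e|[p hp e]].
- by rewrite e in r; constructor 2.
- by constructor 3; exists p, g'; split=> //; left.
- by case: e => <-; constructor 1.
by constructor 3; exists p, (Junk :: g''); split=> //; right; exists g''.
Qed.

Lemma run_block_initial_inv ga g s y :
  run (block (None, ga) ++ s) (g, None) y ->
  exists p g', [/\ g = p ++ g', all (pred1 Junk) p &
    run s (Junk :: g', None) y \/
    run s (Junk :: Done :: codes ga ++ Tail :: Bottom :: g', None) y].
Proof.
rewrite /block /= => /run_start_inv/run_put_inv[p [g' [-> hp]]].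
move/run_push_inv/run_replace_inv => r; exists p, g'; split=> //.
by case: r => // [r|[g'' [<-] r]]; [right|left].
Qed.

Lemma run_close p q b g s y :
    all (pred1 Junk) p -> all (pred1 Tail) q -> all (pred1 Bottom) b ->
  run s (Ready :: g, None) y ->
  run (close ++ s) (p ++ Done :: q ++ b ++ g, None) y.
Proof.
move=> hp hq hb r; apply: run_start; apply: run_absorbs => //; apply: run_pop.
apply: run_absorbs => //; apply: run_goto; apply: run_absorbs => //.
exact: run_put.
Qed.

Lemma run_close_inv g s y :
  run (close ++ s) (g, None) y ->
  exists p q b g', [/\ g = p ++ Done :: q ++ b ++ g', all (pred1 Junk) p,
    all (pred1 Tail) q, all (pred1 Bottom) b & run s (Ready :: g', None) y].
Proof.
move=> /run_start_inv/run_pop_inv[p [g1 [-> hp]]].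
move=> /run_goto_inv[q [g2 [-> hq]]] /run_put_inv[b [g' [-> hb r]]].
by exists p, q, b, g'.
Qed.

(** * Reachable stacks *)

(** Each applied rule leaves a [Tail], which stays between codes until it comes right under [Done]
    and [close] can discard it. *)
Inductive stacked : seq M -> seq token -> Prop :=
  | stacked_nil : stacked [::] [:: Bottom]
  | stacked_tail ga g : stacked ga g -> stacked ga (Tail :: g)
  | stacked_cons X ga g : stacked ga g -> stacked (X :: ga) (code X ++ g).

Lemma code_head X g : exists2 t, digit t & exists g', code X ++ g = t :: g'.
Proof.
by rewrite /code; case: (nat_of_ord _) => [|n]; [exists Zero|exists One] => //=;
  eexists.
Qed.

Lemma stacked_codes ga de g : stacked de g -> stacked (ga ++ de) (codes ga ++ g).
Proof.
move=> sg; elim: ga => //= X ga IHga.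
by rewrite /codes /= -catA; constructor.
Qed.

Lemma stacked_code_inv X ga g :
  stacked ga (code X ++ g) -> exists2 de, ga = X :: de & stacked de g.
Proof.
have [t dt [g' eg]] := code_head X g.
move eh: (code X ++ g) => h sh; case: sh eh => [|de h' _|Y de h' sh].
- by rewrite eg => -[e]; rewrite e in dt.
- by rewrite eg => -[e]; rewrite e in dt.
by case/code_inj=> -> ->; exists de.
Qed.

Lemma stacked_tail_inv ga g : stacked ga (Tail :: g) -> stacked ga g.
Proof.
move eh: (Tail :: g) => h sh; case: sh eh => // [de h' sh [->] //|Y de h' _].
by have [t dt [g' ->]] := code_head Y h' => -[e]; rewrite -e in dt.
Qed.

Lemma stacked_bottom_inv ga g : stacked ga (Bottom :: g) -> ga = [::] /\ g = [::].
Proof.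
move eh: (Bottom :: g) => h sh; case: sh eh => // [[->] //|Y de h' _].
by have [t dt [g' ->]] := code_head Y h' => -[e]; rewrite -e in dt.
Qed.

Lemma stacked_junk ga g : ~ stacked ga (Junk :: g).
Proof.
move eh: (Junk :: g) => h sh; case: sh eh => // Y de h' _.
by have [t dt [g' ->]] := code_head Y h' => -[e]; rewrite -e in dt.
Qed.

Lemma stacked_nonempty ga : ~ stacked ga [::].
Proof.
move eh: [::] => h sh; case: sh eh => // Y de h' _.
by have [t dt [g' ->]] := code_head Y h'.
Qed.

Lemma stacked_tails_inv p ga g : all (pred1 Tail) p ->
  stacked ga (p ++ g) -> stacked ga g.
Proof. by elim: p => //= t p IHp /andP[/eqP-> /IHp{}IHp] /stacked_tail_inv. Qed.

(** Here [y] lies on [x]. [Tail] on [Junk] betrays a rule applied to a decoy, [Bottom] on any of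
    these a second initialization; [Ready] and [Done] as [y] preserve the damage through [close]. *)
Definition clash (y x : token) : bool :=
  (x \in [:: Ready; Done; Junk]) && (y \in [:: Tail; Bottom; Ready; Done]).

(* A stack with a clash is lost: no block can remove the clash, since a token
   lying on [Ready], [Done] or [Junk] is only ever replaced by [Ready]. *)
Fixpoint alive (g : seq token) : bool :=
  if g is y :: g' then (if g' is x :: _ then ~~ clash y x else true) && alive g'
  else true.

Lemma alive_suffix p g : alive (p ++ g) -> alive g.
Proof. by elim: p => //= t p IHp /andP[_]. Qed.

Lemma alive_junk g : alive (Junk :: g) = alive g.
Proof. by case: g => //= t g; rewrite /clash andbF. Qed.

Lemma alive_digits p g : all digit p -> alive (p ++ g) = alive g.
Proof.
elim: p => //= t p IHp /andP[dt /IHp->]; case: (p ++ g) => //= u q.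
by rewrite /clash; case: t dt; rewrite ?andbF.
Qed.

Lemma alive_ready X g : alive (Ready :: code X ++ g) = alive g.
Proof.
rewrite /= (alive_digits _ (digit_code X)).
by have [t dt [g' ->]] := code_head X g; case: t dt.
Qed.

(** [Ready], [Done], [Tail] and [Bottom] clash with the same tokens below them. Read
    contrapositively, [close] repairs no stack. *)
Lemma alive_done p g : all (mem [:: Tail; Bottom]) p ->
  alive (Ready :: g) -> alive (Done :: p ++ g).
Proof.
move=> hp ag; pose heavy := mem [:: Tail; Bottom; Ready; Done].
suff: forall y, heavy y -> alive (y :: p ++ g) by apply.
elim: p hp => [_ y hy|t p IHp /andP[ht /IHp{}IHp] y _].
  case: g ag => // x g /=; rewrite /clash andbT => /andP[+ ->].
  by move/negPf->.
rewrite cat_cons [alive _]/= -/(alive (t :: p ++ g)) IHp ?andbT.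
  by rewrite /clash; case: t ht.
by case: t ht.
Qed.

(** The phases: before the first letter, between letters, after a rule within a letter, after
    [Bottom] was discarded, and spoiled by a clash. The lists are the nonterminals on the stack. *)
Inductive status :=
  Fresh | Waiting of seq M | Served of seq M | Finished | Dead.

Inductive has : seq token -> status -> Prop :=
  | has_fresh : has [::] Fresh
  | has_waiting ga g : stacked ga g -> has (Ready :: g) (Waiting ga)
  | has_served ga g : stacked ga g -> has (Done :: g) (Served ga)
  | has_finished : has [:: Ready] Finished
  | has_junk g st : has g st -> has (Junk :: g) st
  | has_dead g : ~~ alive g -> has g Dead.

Lemma has_unjunk p g st : all (pred1 Junk) p -> has (p ++ g) st -> has g st.
Proof.
elim: p => //= t p IHp /andP[/eqP-> /IHp{}IHp] h; apply: IHp.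
by inversion h; subst => //; constructor; rewrite -alive_junk.
Qed.

Inductive fires : option M * seq M -> status -> seq M -> Prop :=
  | fires_rule X ga de : fires (Some X, ga) (Waiting (X :: de)) (ga ++ de)
  | fires_initial ga : fires (None, ga) Fresh ga.

(** A mismatched choice creates a clash or needs [Junk] under a code, which [stacked] excludes.
    Tokens removed from a dead stack are never the upper half of a clash, so it stays dead. *)
Lemma run_block_has r g st s y :
  has g st -> run (block r ++ s) (g, None) y ->
  exists g' st', [/\ has g' st', run s (g', None) y &
    [\/ st' = st, st' = Dead | exists2 ga, fires r st ga & st' = Served ga]].
Proof.
have dead_on p t u g0 : clash t u -> has (p ++ t :: u :: g0) Dead.
  by move=> c; constructor; apply/negP=> /alive_suffix /=; rewrite c.
move=> hg; case: r => -[X|] ga.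
  case/run_block_rule_inv=> [r|r|[p [g' [hp eg r]]]].
  - by exists (Junk :: g), st; split=> //; [constructor | constructor 1].
  - exists (Junk :: Done :: codes ga ++ Tail :: Junk :: g), Dead; split=> //.
      exact: (dead_on (Junk :: Done :: codes ga)).
    by constructor 2.
  rewrite eg in hg; have {}hg := has_unjunk hp hg.
  case: r => [r|[g'' eg' r]].
    exists (Junk :: Done :: codes ga ++ Tail :: g').
    inversion hg as [|de h sh e1 e2| |e1 e2| |h na e1 e2]; subst.
    + have [de' -> sg] := stacked_code_inv sh.
      exists (Served (ga ++ de')); split=> //.
        by do 2!constructor; apply: stacked_codes; constructor.
      by constructor 3; exists (ga ++ de') => //; constructor.
    + by have [t _ [h]] := code_head X g'; rewrite -e1.
    exists Dead; split=> //; last by constructor 2.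
    constructor; apply: contra na; rewrite alive_ready.
    by move/(@alive_suffix [:: Junk, Done & codes ga])/(@alive_suffix [:: Tail]).
  exists g'; inversion hg as [|de h sh e1 e2| |e1 e2| |h na e1 e2]; subst.
  + by have [de' _ /stacked_junk] := stacked_code_inv sh.
  + by have [t _ [h]] := code_head X (Junk :: g''); rewrite -e1.
  exists Dead; split=> //; last by constructor 2.
  by rewrite alive_ready in na; constructor.
case/run_block_initial_inv=> p [g' [eg hp r]].
rewrite eg in hg; have {}hg := has_unjunk hp hg.
case: r => r.
  by exists (Junk :: g'), st; split=> //; [constructor | constructor 1].
exists (Junk :: Done :: codes ga ++ Tail :: Bottom :: g').
have dead_init u g0 : clash Bottom u ->
    has (Junk :: Done :: codes ga ++ Tail :: Bottom :: u :: g0) Dead.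
  move=> c; have := dead_on (Junk :: Done :: codes ga ++ [:: Tail]) _ _ g0 c.
  by rewrite /= -catA.
case: hg {eg} r => [|de h _|de h _||h st' _|h na] r.
- exists (Served ga); split=> //.
    have := stacked_codes ga (stacked_tail stacked_nil).
    by rewrite cats0 => sg; do 2!constructor.
  by constructor 3; exists ga => //; constructor.
- by exists Dead; split=> //; [exact: dead_init | constructor 2].
- by exists Dead; split=> //; [exact: dead_init | constructor 2].
- by exists Dead; split=> //; [exact: dead_init | constructor 2].
- by exists Dead; split=> //; [exact: dead_init | constructor 2].
exists Dead; split=> //; last by constructor 2.
constructor; apply: contra na.
by move/(@alive_suffix [:: Junk, Done & codes ga])/(@alive_suffix [:: Tail; Bottom]).
Qed.

(** No rule fires on [Served], so at most one rule is applied per letter. *)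
Lemma run_blocks_has rs g st s y :
  has g st -> run (flatten (map block rs) ++ s) (g, None) y ->
  exists g' st', [/\ has g' st', run s (g', None) y &
    [\/ st' = st, st' = Dead |
        exists r ga, [/\ r \in rs, fires r st ga & st' = Served ga]]].
Proof.
elim: rs g st => [|r rs IHrs] g st hg /=.
  by move=> rg; exists g, st; split=> //; constructor 1.
rewrite -catA => /(run_block_has hg)[g1 [st1 [h1 r1 c1]]].
have [g2 [st2 [h2 r2 c2]]] := IHrs _ _ h1 r1.
exists g2, st2; split=> //.
case: c1 c2 => [->|->|[ga f ->]] [->|->|[r' [ga' [i f' ->]]]].
- by constructor 1.
- by constructor 2.
- by constructor 3; exists r', ga'; rewrite inE i orbT.
- by constructor 2.
- by constructor 2.
- by inversion f'.
- by constructor 3; exists r, ga; rewrite inE eqxx.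
- by constructor 2.
by inversion f'.
Qed.

(** [close] pops [Done], so a live stack must be [Served]; [Bottom] can be discarded only when no
    code lies above it. *)
Lemma run_close_has g st s y :
  has g st -> run (close ++ s) (g, None) y ->
  exists g' st', [/\ has g' st', run s (g', None) y &
    st' = Dead \/ exists2 ga, st = Served ga &
      st' = Waiting ga \/ ga = [::] /\ st' = Finished].
Proof.
move=> hg /run_close_inv[p [q [b [g' [eg hp hq hb r]]]]].
rewrite eg in hg; have {}hg := has_unjunk hp hg; exists (Ready :: g').
inversion hg as [| |ga h sh e1 e2| | |h na e1 e2]; subst; last first.
  exists Dead; split=> //; last by left.
  constructor; apply: contra na; rewrite catA; apply: alive_done.
  rewrite all_cat; apply/andP; split.
    by apply: sub_all hq => t /= /eqP->.
  by apply: sub_all hb => t /= /eqP->.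
have {}sh := stacked_tails_inv hq sh; case: b hb sh {hg} => [|t b] /=.
  by move=> _ sh; exists (Waiting ga); split; [constructor| |right; exists ga => //; left].
case/andP=> /eqP-> _ /stacked_bottom_inv[-> /eqP].
rewrite -size_eq0 size_cat addn_eq0 !size_eq0 => /andP[_ /eqP eg'].
exists Finished; split=> //; first by rewrite eg'; constructor.
by right; exists [::] => //; right.
Qed.

(** * Images of words and acceptance by a stack of nonterminals *)

Section Reduction.
Variable Sigma : finType.
Variable rules : Sigma -> seq (option M * seq M).

Definition image (a : Sigma) : seq symbol := flatten (map block (rules a)) ++ close.

(** Leftmost derivations in Greibach normal form, seen as a one-state pushdown automaton accepting
    by empty stack. *)
Inductive accept : seq M -> seq Sigma -> Prop :=
  | accept_nil : accept [::] [::]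
  | accept_cons X ga de a u :
      (Some X, ga) \in rules a -> accept (ga ++ de) u -> accept (X :: de) (a :: u).

Lemma run_image_has g st a s y :
  has g st -> (forall ga, st <> Served ga) ->
  run (image a ++ s) (g, None) y ->
  exists g' st', [/\ has g' st', run s (g', None) y &
    st' = Dead \/ exists r ga, [/\ r \in rules a, fires r st ga &
      st' = Waiting ga \/ ga = [::] /\ st' = Finished]].
Proof.
move=> hg ns; rewrite /image -catA => /(run_blocks_has hg)[g1 [st1 [h1 r1 c1]]].
have [g2 [st2 [h2 r2 c2]]] := run_close_has h1 r1.
exists g2, st2; split=> //.
case: c2 => [->|[ga e2 c2]]; first by left.
case: c1 => [e1|e1|[r [ga' [i f e1]]]].
- by case: (ns ga); rewrite -e1.
- by rewrite e1 in e2.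
by right; exists r, ga; split=> //; move: e2; rewrite e1 => -[<-].
Qed.

Lemma run_dead g u : has g Dead -> ~ run (hom_ext image u) (g, None) ([:: Ready], None).
Proof.
elim: u g => [|a u IHu] g hg.
  by move=> r; inversion r; subst; inversion hg.
rewrite /hom_ext /= => /(run_image_has hg)[//|g' [st' [h' r' [e|[r [ga [_ f _]]]]]]].
  by rewrite e in h'; apply: IHu h' r'.
by inversion f.
Qed.
Lemma run_finished g u :
  has g Finished -> run (hom_ext image u) (g, None) ([:: Ready], None) -> u = [::].
Proof.
case: u => // a u hg; rewrite /hom_ext /= => /(run_image_has hg)[//|g' [st' [h' r' c]]].
case: c => [e|[r [ga [_ f _]]]]; last by inversion f.
by rewrite e in h'; case: (run_dead h' r').
Qed.

Lemma run_waiting ga g u : has g (Waiting ga) ->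
  run (hom_ext image u) (g, None) ([:: Ready], None) -> accept ga u.
Proof.
elim: u ga g => [|a u IHu] ga g hg.
  move=> r; inversion r; subst; inversion hg; subst.
  by case: (@stacked_nonempty ga).
rewrite /hom_ext /= => /(run_image_has hg)[//|g' [st' [h' r' c]]].
case: c => [e|[r [de [i f c]]]].
  by rewrite e in h'; case: (run_dead h' r').
inversion f; subst; apply: accept_cons i _.
case: c => [e|[e1 e2]]; first by rewrite e in h'; apply: IHu h' r'.
by rewrite e2 in h'; rewrite (run_finished h' r') e1; constructor.
Qed.

Lemma run_accept a u :
  run (hom_ext image (a :: u)) ([::], None) ([:: Ready], None) ->
  exists2 ga, (None, ga) \in rules a & accept ga u.
Proof.
rewrite /hom_ext /= => /(run_image_has has_fresh)[//|g' [st' [h' r' c]]].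
case: c => [e|[r [de [i f c]]]].
  by rewrite e in h'; case: (run_dead h' r').
inversion f; subst; exists de => //.
case: c => [e|[e1 e2]]; first by rewrite e in h'; apply: run_waiting h' r'.
by rewrite e2 in h'; rewrite (run_finished h' r') e1; constructor.
Qed.

Lemma run_blocks_skip rs g s y :
  (forall p, all (pred1 Junk) p -> run s (p ++ g, None) y) ->
  run (flatten (map block rs) ++ s) (g, None) y.
Proof.
elim: rs g => [|r rs IHrs] g /= rg; first exact: (rg [::]).
rewrite -catA; apply/run_block_skip/IHrs => p hp.
by have := rg (rcons p Junk); rewrite all_rcons hp cat_rcons; apply.
Qed.

(** The block of [r] acts while all others are skipped, each leaving one [Junk]; hence the arbitrary
    [p]. *)
Lemma run_image r a g g' s y : r \in rules a ->
  (forall p s', all (pred1 Junk) p ->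
     run s' (g', None) y -> run (block r ++ s') (p ++ g, None) y) ->
  (forall p, all (pred1 Junk) p -> run (close ++ s) (p ++ g', None) y) ->
  run (image a ++ s) (g, None) y.
Proof.
move=> ra rb rc; rewrite /image; case/splitPr: ra => rs1 rs2.
rewrite map_cat flatten_cat -!catA; apply: run_blocks_skip => p hp.
by rewrite -?catA; apply: rb => //; apply: run_blocks_skip.
Qed.

Lemma stacked_tails ga g : stacked ga g ->
  exists p g', [/\ g = p ++ g', all (pred1 Tail) p &
    match ga with
    | [::] => g' = [:: Bottom]
    | X :: de => exists2 h, g' = code X ++ h & stacked de h
    end].
Proof.
elim=> {ga g} [|ga g _ [p [g' [-> hp c]]]|X ga g sg _].
- by exists [::], [:: Bottom].
- by exists (Tail :: p), g'.
by exists [::], (code X ++ g); split=> //; exists g.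
Qed.

Lemma accept_run ga u : accept ga u -> forall p g, all (pred1 Junk) p ->
  stacked ga g ->
  run (close ++ hom_ext image u) (p ++ Done :: g, None) ([:: Ready], None).
Proof.
elim=> {ga u} [|X ga de a u i _ IH] p g hp /stacked_tails[q [g' [-> hq c]]].
  (* At the end of the word the choice is to discard [Bottom], leaving [Ready] alone. *)
  rewrite c; apply: (@run_close p q [:: Bottom] [::]) => //; exact: run_nil.
case: c => h -> sh; apply: (@run_close p q [::]) => //.
rewrite /hom_ext /= -/(hom_ext image u).
apply: (@run_image _ _ _ (Junk :: Done :: codes ga ++ Tail :: h) _ _ i).
  by move=> p' s' hp' r; apply: run_block_rule.
move=> p' hp'; rewrite -(cat_rcons Junk p'); apply: IH; first by rewrite all_rcons.
by apply: stacked_codes; constructor.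
Qed.

Lemma run_image_accept a u :
  run (hom_ext image (a :: u)) ([::], None) ([:: Ready], None) <->
  exists2 ga, (None, ga) \in rules a & accept ga u.
Proof.
split=> [|[ga i acc]]; first exact: run_accept.
rewrite /hom_ext /= -/(hom_ext image u).
apply: (@run_image _ _ _ (Junk :: Done :: codes ga ++ [:: Tail; Bottom]) _ _ i).
  by move=> p s' hp r; rewrite cats0; apply: run_block_initial.
move=> p hp; rewrite -(cat_rcons Junk p); apply: (accept_run acc).
  by rewrite all_rcons.
have := stacked_codes ga (stacked_tail stacked_nil).
by rewrite cats0.
Qed.

End Reduction.
End Blocks.

(** * Greibach normal form *)

Section LeftCorner.
Variables (Sigma N : finType) (G : cfgrammar Sigma N).
Implicit Types (g : seq (N + Sigma)) (u v w : seq Sigma).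

Definition word w : seq (N + Sigma) := map inr w.

Lemma derives_context g1 g2 l r :
  cfg_derives G g1 g2 -> cfg_derives G (l ++ g1 ++ r) (l ++ g2 ++ r).
Proof.
elim=> {g1 g2} [g1 g2 d|g|g1 g2 g3 _ IH1 _ IH2].
- case: d => X rhs g1' g2' i; apply: rt_step.
  have := @CFGDerive1 _ _ G X rhs (l ++ g1') (g2' ++ r) i.
  by rewrite -!catA.
- exact: rt_refl.
exact: rt_trans IH1 IH2.
Qed.

Lemma derives_cat g1 g2 h1 h2 :
  cfg_derives G g1 h1 -> cfg_derives G g2 h2 -> cfg_derives G (g1 ++ g2) (h1 ++ h2).
Proof.
move=> /(@derives_context _ _ [::] g2) d1 /(@derives_context _ _ h1 [::]) d2.
by apply: rt_trans d1 _; rewrite !cats0 in d2.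
Qed.

(** Derivation forests, which allow induction along the leftmost symbol. *)
Inductive yields : seq (N + Sigma) -> seq Sigma -> Prop :=
  | yields_nil : yields [::] [::]
  | yields_terminal a g w : yields g w -> yields (inr a :: g) (a :: w)
  | yields_rule X rhs g u v :
      (X, rhs) \in cfg_rules G -> yields rhs u -> yields g v ->
      yields (inl X :: g) (u ++ v).

Lemma yields_word w : yields (word w) w.
Proof. by elim: w => [|a w IHw]; constructor. Qed.

Lemma yields_join g1 g2 u v : yields g1 u -> yields g2 v -> yields (g1 ++ g2) (u ++ v).
Proof.
move=> y1 y2; elim: y1 => //= [a g w _|X rhs g u1 v1 i yr _ _ IH].
  exact: yields_terminal.
by rewrite -catA; apply: yields_rule i yr IH.
Qed.

Lemma yields_split g1 g2 w : yields (g1 ++ g2) w ->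
  exists u v, [/\ w = u ++ v, yields g1 u & yields g2 v].
Proof.
elim: g1 w => [|x g1 IHg] w /= y.
  by exists [::], w; split=> //; constructor.
inversion y as [|a g w' y' e1 e2|X rhs g u1 v1 i yr y' e1 e2]; subst.
  have [u [v [-> yu yv]]] := IHg _ y'.
  by exists (a :: u), v; split=> //; constructor.
have [u [v [-> yu yv]]] := IHg _ y'.
by exists (u1 ++ u), v; split; rewrite ?catA //; apply: yields_rule i yr yu.
Qed.

Lemma derives_yields g w : cfg_derives G g (word w) -> yields g w.
Proof.
move eh: (word w) => h d.
have {eh}: yields h w by rewrite -eh; apply: yields_word.
elim: d => {g h} [g h d|//|g1 g2 g3 _ IH1 _ IH2 /IH2/IH1//].
case: d => X rhs l r i /yields_split[u [v [-> yu /yields_split[v1 [v2 [-> y1 y2]]]]]].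
by apply: yields_join yu _; apply: yields_rule i y1 y2.
Qed.

Lemma yields_derives g w : yields g w -> cfg_derives G g (word w).
Proof.
elim=> {g w} [|a g w _ IH|X rhs g u v i _ IH1 _ IH2].
- exact: rt_refl.
- exact: (derives_cat (rt_refl _ _ [:: inr a]) IH).
rewrite /word map_cat; apply: (@derives_cat [:: inl X]) IH2.
apply: rt_trans IH1; apply: rt_step.
by have := @CFGDerive1 _ _ G X rhs [::] [::] i; rewrite /= cats0.
Qed.

(** A finite set holding single symbols and right-hand sides and closed under removing the first
    symbol; these are the possible left corners and remainders. *)
Definition items : seq (seq (N + Sigma)) :=
  [::] :: [seq [:: x] | x <- enum {: N + Sigma}] ++
  flatten [seq [seq drop i r.2 | i <- iota 0 (size r.2).+1] | r <- cfg_rules G].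

Lemma items_single x : [:: x] \in items.
Proof. by rewrite inE mem_cat map_f ?orbT ?mem_enum. Qed.

Lemma items_drop X rhs i : (X, rhs) \in cfg_rules G -> drop i rhs \in items.
Proof.
move=> hr; have [lt|ge] := leqP i (size rhs); last first.
  by rewrite drop_oversize ?inE // ltnW.
rewrite inE mem_cat; apply/orP; right; apply/orP; right; apply/flattenP.
exists [seq drop j rhs | j <- iota 0 (size rhs).+1].
  by apply/mapP; exists (X, rhs).
by apply/mapP; exists i; rewrite ?mem_iota.
Qed.

Lemma items_behead g : g \in items -> behead g \in items.
Proof.
rewrite inE mem_cat => /or3P[/eqP->|/mapP[x _ ->]|] //.
case/flattenP=> s /mapP[[X rhs] i ->] /mapP[j _ ->] /=.
by rewrite -drop1 drop_drop; apply: items_drop i.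
Qed.

Definition item : finType := seq_sub items.

Definition single (x : N + Sigma) : item := SeqSub (items_single x).

(* The nonterminal [(A, B)] of the Greibach normal form generates the words [u]
   such that [A] derives [B u]: what remains of [A] after its left corner [B].
   Here [u] may be empty; [corner_short] removes the empty word. *)
Inductive corner : item -> item -> seq Sigma -> Prop :=
  | corner_nil (A B : item) :
      cfg_derives G (val A) (val B) -> corner A B [::]
  | corner_cons (A B A' C : item) a u v :
      cfg_derives G (val A') (val B ++ val C) ->
      corner C (single (inr a)) u -> corner A A' v -> corner A B (a :: u ++ v).

(** [A] derives [B u] and then [C v u]. If [v] is empty, [C] replaces [B] in the first step of the
    other corner. *)
Lemma corner_trans A B C u v : corner A B u -> corner B C v -> corner A C (v ++ u).
Proof.
move=> cu cv; elim: cv A u cu => {B C v} [B C d|B C B' D a v1 v2 d c1 _ _ IH] A u cu.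
  case: cu d => [A' B' d'|A' B' A1 D a u1 u2 d' c1 c2] d.
    by apply: corner_nil; apply: rt_trans d' d.
  apply: corner_cons c1 c2; apply: rt_trans d' _.
  exact: derives_cat d (rt_refl _ _ _).
by rewrite /= -catA; apply: corner_cons d c1 (IH _ _ cu).
Qed.

(** The leftmost branch of the derivation is followed down to the first letter, collecting what each
    level leaves to the right. *)
Lemma yields_corner g w : yields g w ->
  forall (A : item) a u, val A = g -> w = a :: u -> corner A (single (inr a)) u.
Proof.
have step (A B C : item) a u v : cfg_derives G (val A) (val B ++ val C) ->
    corner C (single (inr a)) u -> corner A B (a :: u).
  move=> d c; rewrite -[u]cats0; apply: corner_cons d c _.
  exact/corner_nil/rt_refl.
elim=> {g w} [|b g w y IH|X rhs g u1 u2 i y1 IH1 y2 IH2] A a u eA //.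
  case=> <- eu; have hg : g \in items.
    by have := items_behead (valP A); rewrite eA.
  case: w y IH eu => [|c w] y IH eu.
    rewrite -eu; apply: corner_nil; rewrite eA.
    exact: (derives_cat (rt_refl _ _ [:: inr b]) (yields_derives y)).
  rewrite -eu; apply: (step _ _ (SeqSub hg)) => //; last exact: IH.
  by rewrite eA; apply: rt_refl.
have hg : g \in items by have := items_behead (valP A); rewrite eA.
have hr : rhs \in items by rewrite -(drop0 rhs); apply: items_drop i.
have dX : cfg_derives G [:: inl X] rhs.
  by apply: rt_step; have := @CFGDerive1 _ _ G X rhs [::] [::] i; rewrite /= cats0.
(* If [rhs] yields the empty word, [X] is erased and the first letter comes from [g]. *)
case: u1 y1 IH1 => [|b u1] y1 IH1 /=.
  move=> eu; have := corner_trans (_ : corner A (SeqSub hg) [::]) (IH2 (SeqSub hg) _ _ erefl eu).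
  rewrite cats0; apply; apply: corner_nil; rewrite eA.
  apply: (@derives_cat [:: inl X] _ [::]) (rt_refl _ _ _).
  exact: rt_trans dX (yields_derives y1).
case=> eb; rewrite eb in y1 IH1 *; move=> <-.
(* Otherwise the letter comes from [X], and the corner from [A] to [a] passes through [X]. *)
have cX : corner (single (inl X)) (single (inr a)) u1.
  have := corner_trans (_ : corner _ (SeqSub hr) [::]) (IH1 (SeqSub hr) _ _ erefl erefl).
  by rewrite cats0; apply; apply: corner_nil.
apply: corner_trans cX; case: u2 y2 IH2 => [|c u2] y2 IH2.
  apply: corner_nil; rewrite eA.
  exact: (derives_cat (rt_refl _ _ [:: inl X]) (yields_derives y2)).
apply: (step _ _ (SeqSub hg)) => //; last exact: IH2.
by rewrite eA; apply: rt_refl.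
Qed.

Definition nonterminal : finType := (item * item)%type.

Definition generates (o : option nonterminal) w : Prop :=
  if o is Some p then cfg_derives G (val p.1) (val p.2 ++ word w)
  else cfg_derives G [:: inl (cfg_start G)] (word w).

Fixpoint stack_generates (ga : seq nonterminal) w : Prop :=
  if ga is p :: de then
    exists u v, [/\ w = u ++ v, generates (Some p) u & stack_generates de v]
  else w = [::].

(* All rules that are sound and have at most two nonterminals on the right. *)
Definition greibach_rules (a : Sigma) : seq (option nonterminal * seq nonterminal) :=
  [seq (x.1, bseqval x.2) |
     x : option nonterminal * {bseq 2 of nonterminal} <-
       enum {: option nonterminal * {bseq 2 of nonterminal}} &
     `[< forall u, stack_generates x.2 u -> generates x.1 (a :: u) >]].

Lemma greibach_rulesP a o ga : reflect
  (size ga <= 2 /\ forall u, stack_generates ga u -> generates o (a :: u))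
  ((o, ga) \in greibach_rules a).
Proof.
apply: (iffP mapP) => [[[o' b]]|[sz snd]].
  by rewrite mem_filter => /andP[/asboolP snd _] [-> ->]; rewrite size_bseq.
exists (o, Bseq sz) => //; rewrite mem_filter mem_enum andbT; exact/asboolP.
Qed.

Lemma stack_generates_cat ga de w : stack_generates (ga ++ de) w ->
  exists u v, [/\ w = u ++ v, stack_generates ga u & stack_generates de v].
Proof.
elim: ga w => [|p ga IHga] w /=; first by exists [::], w.
case=> u [v [-> gu /IHga[v1 [v2 [-> g1 g2]]]]].
by exists (u ++ v1), v2; split; rewrite ?catA //; exists u, v1.
Qed.

Lemma accept_generates ga w : accept greibach_rules ga w -> stack_generates ga w.
Proof.
elim=> {ga w} [|p ga de a u /greibach_rulesP[_ snd] _] //=.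
move=> /stack_generates_cat[v [w [-> gv gw]]].
by exists (a :: v), w; split=> //; apply: snd.
Qed.

Lemma accept_cat ga de u v : accept greibach_rules ga u ->
  accept greibach_rules de v -> accept greibach_rules (ga ++ de) (u ++ v).
Proof.
move=> au av; elim: au => //= p ga1 de1 a w i _ IH.
by apply: accept_cons i _; rewrite catA.
Qed.

(** An empty remainder becomes the empty list, any other the single nonterminal [(A, B)]. So no
    nonterminal has to generate the empty word, and a rule needs at most two on its right. *)
Lemma corner_short A B u : corner A B u ->
  exists ga, [/\ size ga <= 1, accept greibach_rules ga u &
    forall v, stack_generates ga v -> generates (Some (A, B)) v].
Proof.
elim=> {A B u} [A B d|A B A' C a u v d _ [ga [sga aga gga]] _ [de [sde ade gde]]].
  by exists [::]; split=> //; [constructor|move=> v /= ->; rewrite cats0].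
exists [:: (A, B)]; split=> //.
  apply: (@accept_cons _ _ _ _ (ga ++ de)).
    apply/greibach_rulesP; split; first by rewrite size_cat (leq_add sga sde).
    move=> w /stack_generates_cat[w1 [w2 [-> /gga d1 /gde d2]]] /=.
    apply: rt_trans d2 _; rewrite /word /= map_cat -cat_cons catA.
    apply: derives_cat (rt_refl _ _ _); apply: rt_trans d _.
    exact: derives_cat (rt_refl _ _ _) d1.
  by rewrite cats0; apply: accept_cat.
by move=> w [w1 [w2 [-> g1 ->]]]; rewrite cats0.
Qed.

(** The list obtained for the corner from the start symbol to [a] serves as the right-hand side of
    an initial rule; soundness of all rules gives the converse. *)
Lemma cfg_language_accept a u : cfg_language G (a :: u) <->
  exists2 ga, (None, ga) \in greibach_rules a & accept greibach_rules ga u.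
Proof.
split=> [/derives_yields y|[ga /greibach_rulesP[_ snd] /accept_generates /snd //]].
have [ga [sga aga gga]] :=
  corner_short (@yields_corner _ _ y (single (inl (cfg_start G))) _ _ erefl erefl).
by exists ga => //; apply/greibach_rulesP; split=> //; apply: leq_trans sga _.
Qed.

End LeftCorner.

Theorem corollary1 :
  exists (Omega : finType) (L0 : language Omega),
    (exists (BC : finType) (G : catgrammar Omega BC),
       unique_assignment G /\
       forall x : seq Omega, L0 x <-> cg_language G x) /\
    forall (Sigma : finType) (L : language Sigma),
      context_free L -> eps_free L ->
      exists h : Sigma -> seq Omega,
        (forall a : Sigma, h a <> [::]) /\
        forall w : seq Sigma, w <> [::] -> (L w <-> L0 (hom_ext h w)).
Proof.
exists symbol, (cg_language machine_grammar); split.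
  by exists state, machine_grammar; split; first exact: machine_grammar_unique.
move=> Sigma L [N [G LG]] _; exists (image (greibach_rules G)); split.
  by move=> a; rewrite /image; case: (flatten _).
case=> // a u _.
rewrite LG cfg_language_accept -run_image_accept machine_languageP.
split=> [r|[//]]; split=> //.
by rewrite /hom_ext /= /image; case: (flatten (map _ _)).
Qed.
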